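(* Let $F$ be a finite loop and $A$ a finite abelian group. Assume that every cocycle $\theta\in C(F,A)$ is separable. Let $G=\mathrm{Aut}(F,A)=\mathrm{Aut}(F)\times\mathrm{Aut}(A)$, and let $\mathrm{Sub}_c(G)$ be a set of subgroups of $G$ containing precisely one representative of each conjugacy class of subgroups of $G$. Then the number of central extensions of $A$ by $F$, up to isomorphism of loops, is $$\sum_{H\in\mathrm{Sub}_c(G)}\frac{|\mathrm{Inv}^*_c(H)|}{|B(F,A)|\cdot[G:H]}=\sum_{H\in\mathrm{Sub}_c(G)}\frac{|\mathrm{Inv}^*(H)|}{|B(F,A)|\cdot[N_G(H):H]}.$$
   Context: A loop is a set with a binary operation having a two-sided neutral element $1$ such that all left and right translations are bijections. The center $Z(Q)$ of a loop $Q$ is the set of all $x\in Q$ with $xy=yx$, $(xy)z=x(yz)$, $(yx)z=y(xz)$, $(yz)x=y(zx)$ for all $y,z\in Q$; it is a normal subloop (kernel of a loop homomorphism). A loop $Q$ is a central extension of $A$ by $F$ if (up to identification) $A\le Z(Q)$ and $Q/A\cong F$. Write $A$ additively. A cocycle is a map $\theta:F\times F\to A$ with $\theta(1,x)=\theta(x,1)=0$ for all $x\in F$; cocycles form an abelian group $C(F,A)$ under pointwise addition. For $\theta\in C(F,A)$, $\mathcal Q(F,A,\theta)$ is the loop on $F\times A$ with multiplication $(x,a)(y,b)=(xy,a+b+\theta(x,y))$; the central extensions of $A$ by $F$ are, up to isomorphism, exactly the loops $\mathcal Q(F,A,\theta)$. For $\tau:F\to A$ with $\tau(1)=0$ put $\widehat\tau(x,y)=\tau(xy)-\tau(x)-\tau(y)$;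 the coboundaries are the elements of the subgroup $B(F,A)=\{\widehat\tau:\ \tau:F\to A,\ \tau(1)=0\}\le C(F,A)$. The group $G=\mathrm{Aut}(F)\times\mathrm{Aut}(A)$ acts on $C(F,A)$ by ${}^{(\alpha,\beta)}\theta(x,y)=\beta\theta(\alpha^{-1}x,\alpha^{-1}y)$. Write $\theta\sim\mu$ if ${}^{(\alpha,\beta)}\theta-\mu\in B(F,A)$ for some $(\alpha,\beta)\in G$. A cocycle $\theta$ is separable if for every $\mu\in C(F,A)$: $\mathcal Q(F,A,\theta)\cong\mathcal Q(F,A,\mu)$ if and only if $\theta\sim\mu$. For $(\alpha,\beta)\in G$ let $\mathrm{Inv}(\alpha,\beta)=\{\theta\in C(F,A):\theta-{}^{(\alpha,\beta)}\theta\in B(F,A)\}$. For $H\le G$ let $\mathrm{Inv}^*(H)=\{\theta\in C(F,A):\ \theta\in\mathrm{Inv}(\alpha,\beta)\text{ if and only if }(\alpha,\beta)\in H\}$ and $\mathrm{Inv}^*_c(H)=\bigcup_{g\in G}\mathrm{Inv}^*(gHg^{-1})$. $N_G(H)$ denotes the normalizer of $H$ in $G$. *)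

(* Defs.v *)
From HB Require Import structures.
From mathcomp Require Import all_boot all_order all_fingroup all_algebra.
From mathcomp Require Import boolp.

Set Implicit Arguments.
Unset Strict Implicit.
Unset Printing Implicit Defensive.

Import GRing.Theory.
Local Open Scope group_scope.
Local Open Scope quotient_scope.

Declare Scope loop_scope.
Delimit Scope loop_scope with L.
Local Open Scope loop_scope.

HB.mixin Record isLoop Q of Choice Q := {
  lone : Q;
  lmul : Q -> Q -> Q;
  lmul1x : left_id lone lmul;
  lmulx1 : right_id lone lmul;
  lmul_bij : forall x, bijective (lmul x);
  lmulr_bij : forall x, bijective (lmul^~ x)
}.

#[short(type="loopType")]
HB.structure Definition Loop := {Q of isLoop Q & Choice Q}.

#[short(type="finLoopType")]
HB.structure Definition FinLoop := {Q of Finite Q & Loop Q}.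

Notation "1" := lone : loop_scope.
Notation "x * y" := (lmul x y) : loop_scope.

Definition loop_iso (P Q : loopType) : Prop :=
  exists2 f : P -> Q, bijective f & {morph f : x y / x * y}.

Lemma loop_iso_sym (P Q : loopType) : loop_iso P Q -> loop_iso Q P.
Proof.
case=> f [g fK gK] fM; exists g; first by exists f.
by move=> x y; apply: (can_inj fK); rewrite fM !gK.
Qed.

Lemma loop_iso_trans (P Q R : loopType) :
  loop_iso P Q -> loop_iso Q R -> loop_iso P R.
Proof.
case=> f fbij fM [g gbij gM]; exists (g \o f); first exact: bij_comp.
by move=> x y; rewrite /= fM gM.
Qed.

Section LoopTheory.
Variable Q : loopType.

Lemma lmulI (x : Q) : injective (fun y : Q => x * y).
Proof. exact: bij_inj (lmul_bij x). Qed.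

Definition in_center (x : Q) : Prop := forall y z : Q,
  [/\ x * y = y * x, (x * y) * z = x * (y * z),
      (y * x) * z = y * (x * z) & (y * z) * x = y * (z * x)].

End LoopTheory.

Section CentralExtensions.
Variables (A : zmodType) (Q : loopType).

Record central_embedding := CentralEmbedding {
  cemb :> A -> Q;
  cemb_inj : injective cemb;
  cembD : forall a b, cemb (a + b)%R = cemb a * cemb b;
  cemb_center : forall a, in_center (cemb a)
}.

Section Quotient.
(* fingroup also has a repr. *)
Local Notation qrepr := generic_quotient.repr.
Variable i : central_embedding.

Lemma cemb0 : i 0%R = 1.
Proof.
by apply: (lmulI (x := i 0%R)); rewrite -cembD addr0 lmulx1.
Qed.

Definition coset_rel (x y : Q) : bool := `[< exists a, y = x * i a >].

Lemma cemb_mulA (x : Q) a b : (x * i a) * i b = x * i (a + b)%R.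
Proof. by rewrite cembD; case: (cemb_center i a x (i b)). Qed.

Lemma cemb_mulM (x y : Q) a b : (x * i a) * (y * i b) = (x * y) * i (a + b)%R.
Proof.
have [_ _ _ <-] := cemb_center i b (x * i a) y.
have [_ _ -> _] := cemb_center i a x y.
have [-> _ _ _] := cemb_center i a y 1.
have [_ _ _ <-] := cemb_center i a x y.
exact: cemb_mulA.
Qed.

Lemma coset_rel_refl : reflexive coset_rel.
Proof. by move=> x; apply/asboolP; exists 0%R; rewrite cemb0 lmulx1. Qed.

Lemma coset_rel_sym : symmetric coset_rel.
Proof.
have sub x y : coset_rel x y -> coset_rel y x.
  move=> /asboolP[a ->]; apply/asboolP; exists (- a)%R.
  by rewrite cemb_mulA subrr cemb0 lmulx1.
by move=> x y; apply/idP/idP; apply: sub.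
Qed.

Lemma coset_rel_trans : transitive coset_rel.
Proof.
move=> y x z /asboolP[a ->] /asboolP[b ->].
by apply/asboolP; exists (a + b)%R; rewrite cemb_mulA.
Qed.

Canonical coset_equiv :=
  EquivRel coset_rel coset_rel_refl coset_rel_sym coset_rel_trans.

(* Q / i(A), the quotient by a central subloop: the cosets x * i(A). *)
Definition quo_loop : Type := {eq_quot coset_equiv}.
HB.instance Definition _ := Choice.on quo_loop.
HB.instance Definition _ := EqQuotient.on quo_loop.

Definition quo_mul : quo_loop -> quo_loop -> quo_loop :=
  lift_op2 quo_loop (fun x y : Q => x * y).
Definition quo_one : quo_loop := \pi_quo_loop 1.

Lemma pi_quoP (x y : Q) :
  reflect (exists a, y = x * i a) (\pi_quo_loop x == \pi_quo_loop y).
Proof. by rewrite eqmodE; apply: asboolP. Qed.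

Lemma quo_mulE (x y : Q) :
  quo_mul (\pi_quo_loop x) (\pi_quo_loop y) = \pi_quo_loop (x * y).
Proof.
rewrite /quo_mul; unlock.
have /eqP/pi_quoP[a ->] : \pi_quo_loop x = \pi_quo_loop (qrepr (\pi_quo_loop x)).
  by rewrite reprK.
have /eqP/pi_quoP[b ->] : \pi_quo_loop y = \pi_quo_loop (qrepr (\pi_quo_loop y)).
  by rewrite reprK.
by apply/eqP; rewrite eq_sym; apply/pi_quoP; exists (a + b)%R; rewrite cemb_mulM.
Qed.

Fact quo_mul1x : left_id quo_one quo_mul.
Proof. by elim/quotW=> x; rewrite quo_mulE lmul1x. Qed.

Fact quo_mulx1 : right_id quo_one quo_mul.
Proof. by elim/quotW=> x; rewrite quo_mulE lmulx1. Qed.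

Lemma cemb_mulCA (x y : Q) a : (x * i a) * y = (x * y) * i a.
Proof. by rewrite -[y in LHS]lmulx1 -cemb0 cemb_mulM addr0. Qed.

Fact quo_lmul_bij (u : quo_loop) : bijective (fun v : quo_loop => quo_mul u v).
Proof.
elim/quotW: u => x; have [g gK Kg] := lmul_bij x.
exists (fun v : quo_loop => \pi_quo_loop (g (qrepr v))).
- elim/quotW=> y; apply/eqP; rewrite eq_sym; apply/pi_quoP.
  have /eqP/pi_quoP[a Da] : \pi_quo_loop (x * y) =
      \pi_quo_loop (qrepr (quo_mul (\pi_quo_loop x) (\pi_quo_loop y))).
    by rewrite reprK quo_mulE.
  exists a; apply: (lmulI (x := x)); rewrite /= Kg Da.
  by case: (cemb_center i a x y).
- by elim/quotW=> y; rewrite quo_mulE Kg reprK.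
Qed.

Fact quo_lmulr_bij (u : quo_loop) : bijective (fun v : quo_loop => quo_mul v u).
Proof.
elim/quotW: u => x; have [g gK Kg] := lmulr_bij x.
exists (fun v : quo_loop => \pi_quo_loop (g (qrepr v))).
- elim/quotW=> y; apply/eqP; rewrite eq_sym; apply/pi_quoP.
  have /eqP/pi_quoP[a Da] : \pi_quo_loop (y * x) =
      \pi_quo_loop (qrepr (quo_mul (\pi_quo_loop y) (\pi_quo_loop x))).
    by rewrite reprK quo_mulE.
  by exists a; apply: (can_inj gK); rewrite /= Kg Da cemb_mulCA.
- by elim/quotW=> y; rewrite quo_mulE Kg reprK.
Qed.

HB.instance Definition _ := isLoop.Build quo_loop quo_mul1x quo_mulx1
  quo_lmul_bij quo_lmulr_bij.

End Quotient.

End CentralExtensions.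

Definition central_extension (A : zmodType) (F Q : loopType) : Prop :=
  exists i : central_embedding A Q, loop_iso (quo_loop i) F.

(* There are exactly n isomorphism classes of central extensions of A by F;
   E lists one representative of each. Isomorphism is isomorphism of loops,
   not equivalence of extensions. *)
Definition central_extension_count (A : zmodType) (F : loopType) (n : nat)
    : Prop :=
  exists E : 'I_n -> loopType,
    [/\ forall k, central_extension A F (E k),
        forall k l, loop_iso (E k) (E l) -> k = l &
        forall Q : loopType, central_extension A F Q ->
          exists k, loop_iso Q (E k)].

Lemma central_extension_count_uniq (A : zmodType) (F : loopType) m n :
  central_extension_count A F m -> central_extension_count A F n -> m = n.
Proof.
suff le p q : central_extension_count A F p ->
    central_extension_count A F q -> p <= q.
  by move=> hm hn; apply/eqP; rewrite eqn_leq !le.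
case=> E [Eext Einj _] [E' [_ _ E'all]].
have [f fP] := choice (fun k => E'all _ (Eext k)).
have f_inj : injective f.
  move=> k l fkl; apply: Einj; apply: loop_iso_trans (fP k) _.
  by rewrite fkl; apply/loop_iso_sym/fP.
by have := leq_card f f_inj; rewrite !card_ord.
Qed.

Section Cocycles.
Variables (F : finLoopType) (A : finZmodType).

Definition is_cocycle (theta : {ffun F * F -> A}) : bool :=
  [forall x, (theta (1, x) == 0%R) && (theta (x, 1) == 0%R)].

Record cocycle := Cocycle {
  cocycle_fun :> {ffun F * F -> A};
  cocycleP : is_cocycle cocycle_fun
}.

HB.instance Definition _ := [isSub for cocycle_fun].
HB.instance Definition _ := [Finite of cocycle by <:].

Definition coboundaries : {set {ffun F * F -> A}} :=
  [set theta : {ffun F * F -> A} | [exists tau : {ffun F -> A},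
    (tau 1 == 0%R) &&
    [forall x, forall y, theta (x, y) == (tau (x * y)%L - tau x - tau y)%R]]].

(* The carrier F * A ignores theta, which only indexes the loop structure. *)
Definition cocycle_loop (theta : cocycle) : Type := F * A.

Section ExtLoop.
Variable theta : cocycle.
Local Notation Q := (cocycle_loop theta).

HB.instance Definition _ := Finite.on Q.

Definition ext_mul (u v : Q) : Q :=
  (u.1 * v.1, (u.2 + v.2 + theta (u.1, v.1))%R).
Definition ext_one : Q := (1, 0%R).

Fact ext_mul1x : left_id ext_one ext_mul.
Proof.
case=> x a; rewrite /ext_mul /= lmul1x add0r.
by have /forallP/(_ x)/andP[/eqP-> _] := cocycleP theta; rewrite addr0.
Qed.

Fact ext_mulx1 : right_id ext_one ext_mul.
Proof.
case=> x a; rewrite /ext_mul /= lmulx1 addr0.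
by have /forallP/(_ x)/andP[_ /eqP->] := cocycleP theta; rewrite addr0.
Qed.

Fact ext_lmul_bij (u : Q) : bijective (fun v : Q => ext_mul u v).
Proof.
case: u => x a; have [g gK Kg] := lmul_bij x.
exists (fun v : Q => (g v.1, (v.2 - theta (x, g v.1) - a)%R)).
- by case=> y b; congr pair; rewrite /= gK // addrK addrC addKr.
- by case=> y b; congr pair; rewrite /= ?Kg // (addrC a) !subrK.
Qed.

Fact ext_lmulr_bij (u : Q) : bijective (fun v : Q => ext_mul v u).
Proof.
case: u => x a; have [g gK Kg] := lmulr_bij x.
exists (fun v : Q => (g v.1, (v.2 - theta (g v.1, x) - a)%R)).
- by case=> y b; congr pair; rewrite /= gK // !addrK.
- by case=> y b; congr pair; rewrite /= ?Kg // !subrK.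
Qed.

HB.instance Definition _ := isLoop.Build Q ext_mul1x ext_mulx1
  ext_lmul_bij ext_lmulr_bij.

End ExtLoop.

Definition loop_aut : {set {perm F}} :=
  [set s : {perm F} | [forall x, forall y, s (x * y) == s x * s y]].

Lemma loop_aut_group_set : group_set loop_aut.
Proof.
apply/group_setP; split=> [|s t].
  by rewrite inE; apply/forallP=> x; apply/forallP=> y; rewrite !perm1.
rewrite !inE => /forallP sM /forallP tM.
apply/forallP=> x; apply/forallP=> y; rewrite !permM.
by rewrite (eqP (forallP (sM x) y)) (eqP (forallP (tM _) _)).
Qed.
Canonical loop_aut_group := Group loop_aut_group_set.

(* Products of permutations are composed left to right here, so this is the
   opposite of the usual Aut(F) x Aut(A); its subgroups, their conjugacy
   classes, normalizers and indices are the same. *)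
Definition AutFA : {group {perm F} * {perm A}} :=
  [group of setX loop_aut (Aut [set: A])].

Definition cocycle_act (g : {perm F} * {perm A}) (theta : {ffun F * F -> A})
    : {ffun F * F -> A} :=
  [ffun p => g.2 (theta (g.1^-1 p.1, g.1^-1 p.2))].

Definition cocycle_sim (theta mu : cocycle) : Prop :=
  exists2 g, g \in AutFA &
    (cocycle_act g theta - cocycle_fun mu)%R \in coboundaries.

Definition separable (theta : cocycle) : Prop :=
  forall mu : cocycle,
    loop_iso (cocycle_loop theta) (cocycle_loop mu) <-> cocycle_sim theta mu.

Definition Inv (g : {perm F} * {perm A}) : {set cocycle} :=
  [set theta : cocycle |
    (cocycle_fun theta - cocycle_act g theta)%R \in coboundaries].

Definition InvS (H : {set {perm F} * {perm A}}) : {set cocycle} :=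
  [set theta : cocycle | [forall g in AutFA, (theta \in Inv g) == (g \in H)]].

(* H :^ g is g^-1 * H * g for the left-to-right product, that is, the
   conjugate g H g^-1 for composition of maps. *)
Definition InvSc (H : {set {perm F} * {perm A}}) : {set cocycle} :=
  \bigcup_(g in AutFA) InvS (H :^ g).

End Cocycles.

Definition subgroup_class_reps (gT : finGroupType) (G : {group gT})
    (S : {set {group gT}}) : Prop :=
  (forall H, H \in S -> H \subset G) /\
  (forall K : {group gT}, K \subset G ->
     exists! H : {group gT}, H \in S /\ exists2 g, g \in G & H = (K :^ g)%G).

(* Main.v *)
(* A section of Q -> Q / A that preserves 1 turns any central extension Q into
   some cocycle_loop theta, so by separability the number n of extensions is
   the number of classes of the relation ~ on cocycles. Hence n is the sum over
   theta of 1 / |class of theta|, and by orbit-stabilizer the class of theta has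
   |B| [G : S] elements, where S is the stabilizer of theta modulo B. Grouping
   the cocycles by the conjugacy class of S gives the first sum; the second one
   follows because InvSc H is the disjoint union of the [G : N_G(H)] equipotent
   sets InvS K, for K conjugate to H. *)

Require Import Defs.
From HB Require Import structures.
From mathcomp Require Import all_boot all_order all_fingroup all_algebra.
From mathcomp Require Import boolp.

Set Implicit Arguments.
Unset Strict Implicit.
Unset Printing Implicit Defensive.

Import GRing.Theory Num.Theory.

Local Open Scope loop_scope.

(** * Central extensions are the loops defined by cocycles *)

Section CocycleLoops.
Variables (F : finLoopType) (A : finZmodType).
Implicit Types theta mu : cocycle F A.

Local Notation qrepr := generic_quotient.repr.

Lemma cocycle1x theta x : theta (1, x) = 0%R.
Proof. by have /forallP/(_ x)/andP[/eqP] := cocycleP theta. Qed.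

Lemma cocyclex1 theta x : theta (x, 1) = 0%R.
Proof. by have /forallP/(_ x)/andP[_ /eqP] := cocycleP theta. Qed.

Lemma cocycle_loopME theta (u v : cocycle_loop theta) :
  u * v = (u.1 * v.1, (u.2 + v.2 + theta (u.1, v.1))%R).
Proof. by []. Qed.

Definition fiber theta (a : A) : cocycle_loop theta := (1, a).

Fact fiber_inj theta : injective (fiber theta).
Proof. by move=> a b []. Qed.

Fact fiberD theta a b : fiber theta (a + b)%R = fiber theta a * fiber theta b.
Proof. by rewrite cocycle_loopME /= lmul1x cocycle1x addr0. Qed.

Fact fiber_center theta a : in_center (fiber theta a).
Proof.
move=> [x b] [y c]; rewrite !cocycle_loopME /=.
rewrite !lmul1x !lmulx1 !cocycle1x !cocyclex1 !addr0.
by split; congr (_, _); rewrite ?[(a + b)%R]addrC -?addrA //;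
  rewrite ?(addrCA a) // ?(addrC a) -?addrA //.
Qed.

Definition fiber_embedding theta : central_embedding A (cocycle_loop theta) :=
  CentralEmbedding (@fiber_inj theta) (@fiberD theta) (@fiber_center theta).

Lemma cocycle_loop_central_extension theta :
  central_extension A F (cocycle_loop theta).
Proof.
pose i := fiber_embedding theta; exists i.
(* The first coordinate is constant on cosets: the chosen representative differs from [u] by a
   factor [(1, a)]. *)
pose f (u : quo_loop i) : F := (qrepr u).1.
have f_pi (u : cocycle_loop theta) : f (\pi_(quo_loop i) u)%qT = u.1.
  rewrite /f; have /eqP/pi_quoP[a ->] :
    (\pi_(quo_loop i) u = \pi_(quo_loop i) (qrepr (\pi_(quo_loop i) u)))%qT.
    by rewrite generic_quotient.reprK.
  by rewrite cocycle_loopME /= lmulx1.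
exists f.
  exists (fun x => \pi_(quo_loop i) ((x, 0%R) : cocycle_loop theta))%qT.
    elim/generic_quotient.quotW=> -[x a]; rewrite f_pi.
    apply/eqP/pi_quoP; exists a.
    by rewrite cocycle_loopME /= lmulx1 cocyclex1 add0r addr0.
  by move=> x; rewrite f_pi.
elim/generic_quotient.quotW=> u; elim/generic_quotient.quotW=> v.
by rewrite [_ * _ in LHS]quo_mulE !f_pi.
Qed.

Lemma central_extension_cocycle (Q : loopType) :
  central_extension A F Q -> exists theta, loop_iso Q (cocycle_loop theta).
Proof.
case=> i [phi [psi phiK psiK] phiM].
pose p (q : Q) : F := phi (\pi_(quo_loop i) q)%qT.
have pM q r : p (q * r) = p q * p r.
  by rewrite /p -phiM; congr phi; rewrite -quo_mulE.
have p_eq q r : p q = p r -> exists a, q = r * i a.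
  by move/(can_inj phiK)/esym/eqP/pi_quoP.
have p1 : p 1 = 1 by apply: (lmulI (x := p 1)); rewrite -pM !lmulx1.
have pi a : p (i a) = 1.
  rewrite -p1; congr phi; apply/esym/eqP/pi_quoP.
  by exists a; rewrite lmul1x.
(* The representative of the trivial coset need not be 1; forcing [s 1 = 1] is what normalizes the
   cocycle. *)
pose s x : Q := if x == 1 then 1 else qrepr (psi x).
have s1 : s 1 = 1 by rewrite /s eqxx.
have sK : cancel s p.
  rewrite /s => x; case: eqP => [->|_]; first exact: p1.
  by rewrite /p generic_quotient.reprK psiK.
(* [t] measures the failure of the section [s] to be multiplicative; it will be the cocycle. *)
have /choice[t tE] (u : F * F) :
    exists a, s u.1 * s u.2 = s (u.1 * u.2) * i a.
  by apply: p_eq; rewrite pM !sK.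
have icancel q : injective (fun a => q * i a).
  by move=> a b /lmulI/cemb_inj.
have t_coc : is_cocycle [ffun u => t u].
  apply/forallP=> x; rewrite !ffunE; apply/andP; split; apply/eqP.
    by apply: (icancel (s x)); rewrite /= cemb0; have /= := tE (1, x);
      rewrite s1 !lmul1x lmulx1.
  by apply: (icancel (s x)); rewrite /= cemb0; have /= := tE (x, 1);
    rewrite s1 !lmulx1.
pose theta := Cocycle t_coc; exists theta; apply: loop_iso_sym.
(* [c q] is the coordinate of [q] in [A] relative to [s], so [q] is recovered from the pair
   [(p q, c q)]. *)
have /choice[c cE] q : exists a, q = s (p q) * i a.
  by apply: p_eq; rewrite sK.
exists (fun u : cocycle_loop theta => s u.1 * i u.2).
  exists (fun q => (p q, c q)) => [[x a] /=|q /=]; last by rewrite -cE.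
  have px : p (s x * i a) = x by rewrite pM sK pi lmulx1.
  rewrite px; congr pair; apply: (icancel (s x)).
  by rewrite /= -{1}px -cE.
move=> [x a] [y b] /=; rewrite cemb_mulM (tE (x, y)) ffunE /=.
by rewrite cemb_mulA addrC.
Qed.

End CocycleLoops.

(** * Counting equivalence classes by weights *)

Lemma sum_inv_card_class (T : finType) (R : rel T) :
    equivalence_rel R ->
  (\sum_x #|[set y | R x y]|%:R^-1 =
    #|equivalence_partition R [set: T]|%:R :> rat)%R.
Proof.
move=> R_eq; set P := equivalence_partition R _.
have R_eqT : {in [set: T] & &, equivalence_rel R} by move=> x y z _ _ _;
  apply: R_eq.
have partP : partition P [set: T] := equivalence_partitionP R_eqT.
rewrite -(eq_bigl _ _ (in_setT (T:=T))) (set_partition_big _ partP) /=.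
rewrite -sum1_card natr_sum; apply: eq_bigr => B PB.
have [_ tiP P0] := and3P partP.
(* A block [B] contributes [#|B|] equal terms [1 / #|B|], hence 1 in total. *)
rewrite (eq_bigr (fun=> #|B|%:R^-1)%R) => [|x Bx].
  rewrite sumr_const -[(_ *+ _)%R]mulr_natr mulVf // pnatr_eq0 -lt0n card_gt0.
  by apply: contraNneq P0 => <-.
congr (_%:R^-1)%R; congr #|pred_of_set _|; apply/setP=> y; rewrite inE.
by rewrite -(pblock_equivalence_partition R_eqT) ?inE // -/P (def_pblock tiP
  PB).
Qed.

(** * The action on cocycles modulo coboundaries *)

Section Counting.
Variables (F : finLoopType) (A : finZmodType).
Implicit Types (theta mu : cocycle F A) (u v w : {ffun F * F -> A}).
Implicit Types g h : {perm F} * {perm A}.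

Local Notation B := (coboundaries F A).
Local Notation G := (AutFA F A).

Lemma AutFA_mul g x y : g \in G -> g.1 (x * y) = g.1 x * g.1 y.
Proof.
by rewrite inE inE => /andP[/forallP/(_ x)/forallP/(_ y)/eqP].
Qed.

Lemma AutFA_add g a b : g \in G -> (g.2 (a + b) = g.2 a + g.2 b)%R.
Proof.
by rewrite inE => /andP[_ /Aut_morphic/morphicP gM]; apply: gM; rewrite inE.
Qed.

Lemma AutFA1 g : g \in G -> g.1 1 = 1.
Proof.
by move=> Gg; apply: (lmulI (x := g.1 1)); rewrite -AutFA_mul // !lmulx1.
Qed.

Lemma AutFA0 g : g \in G -> (g.2 0 = 0)%R.
Proof. by move=> Gg; apply: (addrI (g.2 0%R));
  rewrite -AutFA_add // !addr0. Qed.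

Lemma AutFAN g a : g \in G -> (g.2 (- a) = - g.2 a)%R.
Proof. by move=> Gg; apply: (addrI (g.2 a));
  rewrite -AutFA_add // !subrr AutFA0. Qed.

Lemma cocycle_act1 u : cocycle_act 1%g u = u.
Proof. by apply/ffunP=> -[x y]; rewrite ffunE /= invg1 !perm1. Qed.

(** Products of permutations compose left to right, so this is a right action. *)
Lemma cocycle_actM g h u :
  cocycle_act (g * h)%g u = cocycle_act h (cocycle_act g u).
Proof. by apply/ffunP=> -[x y]; rewrite !ffunE /= invMg !permM. Qed.

Lemma cocycle_actB g u v : g \in G ->
  (cocycle_act g (u - v) = cocycle_act g u - cocycle_act g v)%R.
Proof. by move=> Gg; apply/ffunP=> p; rewrite !ffunE AutFA_add // AutFAN. Qed.

Lemma cocycle_act_cocycle g theta :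
  g \in G -> is_cocycle (cocycle_act g theta).
Proof.
move=> Gg; have Gg' : (g^-1)%g \in G by rewrite groupV.
apply/forallP=> x; rewrite !ffunE /= (AutFA1 Gg').
by rewrite cocycle1x cocyclex1 AutFA0 // eqxx.
Qed.

Lemma coboundaryP u :
  reflect (exists2 t : F -> A, t 1 = 0%R
           & forall x y, u (x, y) = (t (x * y)%L - t x - t y)%R)
          (u \in B).
Proof.
rewrite inE; apply: (iffP existsP) =>
  [[t /andP[/eqP t1 /forallP tE]] | [t t1 tE]].
  by exists t => // x y; apply/eqP; have /forallP := tE x; apply.
exists [ffun x => t x]; rewrite ffunE t1 eqxx.
by apply/forallP=> x; apply/forallP=> y; rewrite !ffunE tE.
Qed.

Lemma coboundaries_zmod : zmod_closed (mem B).
Proof.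
split=> [|u v /coboundaryP[s s1 sE] /coboundaryP[t t1 tE]]; apply/coboundaryP.
  by exists (fun=> 0%R) => // x y; rewrite ffunE !subr0.
exists (fun x => s x - t x)%R => [|x y]; first by rewrite s1 t1 subrr.
rewrite !ffunE sE tE !opprD !opprK [LHS]addrACA; congr (_ + _)%R.
exact: addrACA.
Qed.

Lemma coboundary0 : (0 : {ffun F * F -> A})%R \in B.
Proof. by case: coboundaries_zmod. Qed.

Lemma coboundaryB u v : u \in B -> v \in B -> (u - v)%R \in B.
Proof. by case: coboundaries_zmod => _; apply. Qed.

Lemma coboundaryN u : (- u \in B)%R = (u \in B).
Proof.
have sub w : w \in B -> (- w)%R \in B.
  by move=> Bw; rewrite -sub0r coboundaryB ?coboundary0.
by apply/idP/idP => /sub //; rewrite opprK.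
Qed.

Lemma coboundary_subC u v : (u - v \in B)%R = (v - u \in B)%R.
Proof. by rewrite -coboundaryN opprB. Qed.

Lemma coboundary_sub_trans v u w :
  (u - v \in B)%R -> (v - w \in B)%R -> (u - w \in B)%R.
Proof.
move=> Buv; rewrite coboundary_subC => /(coboundaryB Buv).
by rewrite opprB addrA subrK.
Qed.

Lemma coboundary_cocycle u : u \in B -> is_cocycle u.
Proof.
case/coboundaryP=> t t1 tE; apply/forallP=> x.
by rewrite !tE lmul1x lmulx1 t1 !subr0 subrr eqxx.
Qed.

Lemma coboundary_act g u : g \in G -> u \in B -> cocycle_act g u \in B.
Proof.
move=> Gg /coboundaryP[t t1 tE]; have Gg' : (g^-1)%g \in G by rewrite groupV.
(* If [u] is the coboundary of [t], its translate is the coboundary of [t] transported by [g]. *)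
apply/coboundaryP; exists (fun x => g.2 (t (g.1^-1%g x))) => [|x y].
  by rewrite (AutFA1 Gg') t1 AutFA0.
by rewrite ffunE /= tE (AutFA_mul _ _ Gg') !AutFA_add // !AutFAN.
Qed.

(** [g] and its inverse both preserve [B], so congruence modulo [B] can be tested after acting; this
    replaces an explicit action on the quotient by [B]. *)
Lemma coboundary_sub_act g u v : g \in G ->
  (cocycle_act g u - cocycle_act g v \in B)%R = (u - v \in B)%R.
Proof.
move=> Gg; rewrite -cocycle_actB //; apply/idP/idP; last exact: coboundary_act.
by rewrite -groupV in Gg => /(coboundary_act Gg);
  rewrite -cocycle_actM mulgV cocycle_act1.
Qed.

(** * Stabilizers of cocycles modulo coboundaries *)

Definition act_cocycle g (Gg : g \in G) theta : cocycle F A :=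
  Cocycle (cocycle_act_cocycle theta Gg).

(** The stabilizer in [G] of the coset of [theta] modulo [B]. *)
Definition inv_stab theta := [set g in G | theta \in Inv g].

Lemma inv_stabE theta g : g \in G ->
  (g \in inv_stab theta) = (cocycle_act g theta - cocycle_fun theta \in B)%R.
Proof. by move=> Gg; rewrite inE Gg inE coboundary_subC. Qed.

Fact inv_stab_group_set theta : group_set (inv_stab theta).
Proof.
apply/group_setP; split=> [|g h Sg Sh].
  by rewrite inv_stabE ?group1 // cocycle_act1 subrr coboundary0.
have [Gg Gh] : g \in G /\ h \in G by move: Sg Sh;
  rewrite !inE => /andP[-> _] /andP[-> _].
rewrite inv_stabE ?groupM // cocycle_actM.
apply: (@coboundary_sub_trans (cocycle_act h theta)); last
  by rewrite -inv_stabE.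
by rewrite coboundary_sub_act // -inv_stabE.
Qed.
Canonical inv_stab_group theta := Group (inv_stab_group_set theta).

Lemma inv_stab_sub theta : inv_stab theta \subset G.
Proof. by rewrite /inv_stab setIdE subsetIl. Qed.

(** [InvS] only tests elements of [G]; for [H] inside [G] this amounts to equality of sets, so the
    sets [InvS H] are the fibers of [inv_stab]. *)
Lemma mem_InvS (H : {set {perm F} * {perm A}}) theta : H \subset G ->
  (theta \in InvS H) = (inv_stab theta == H).
Proof.
move=> sHG; rewrite inE; apply/forall_inP/eqP => [InvH | <- g Gg].
  apply/setP=> g; rewrite inE; have [Gg|nGg] := boolP (g \in G).
    by rewrite (eqP (InvH g Gg)).
  by apply/esym/negbTE; apply: contra nGg; apply: (subsetP sHG).
by rewrite [in X in _ == X]inE Gg.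
Qed.

(** For a right action, [h] fixes the translate by [g] exactly when [g h g^-1] fixes the
    original. *)
Lemma inv_stab_act g theta (Gg : g \in G) :
  inv_stab (act_cocycle Gg theta) = (inv_stab theta :^ g)%g.
Proof.
apply/setP=> h; rewrite mem_conjg conjgE invgK.
have [Gh|nGh] := boolP (h \in G); last first.
  rewrite [LHS]inE (negbTE nGh) [RHS]inE.
  by rewrite (groupMl _ Gg) groupMr ?groupV // (negbTE nGh).
rewrite !inv_stabE ?groupM ?groupV //= -[RHS](coboundary_sub_act _ _ Gg).
by rewrite -!cocycle_actM -!mulgA mulVg mulg1.
Qed.

(** * The similarity relation and the size of its classes *)

Definition cocycle_simb : rel (cocycle F A) := fun theta mu =>
  [exists g in G, (cocycle_act g theta - cocycle_fun mu)%R \in B].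

Lemma cocycle_simP theta mu
  : reflect (cocycle_sim theta mu) (cocycle_simb theta mu).
Proof. exact: exists_inP. Qed.

Lemma cocycle_simb_equiv : equivalence_rel cocycle_simb.
Proof.
have simb_refl : reflexive cocycle_simb.
  by move=> theta; apply/exists_inP; exists 1%g;
    rewrite ?group1 // cocycle_act1 subrr coboundary0.
have simb_sym : symmetric cocycle_simb.
  suff sub theta mu : cocycle_simb theta mu -> cocycle_simb mu theta
    by move=> ? ?; apply/idP/idP; apply: sub.
  case/exists_inP=> g Gg Bg; apply/exists_inP; exists g^-1%g; first
    by rewrite groupV.
  by rewrite coboundary_subC -(coboundary_sub_act _ _ Gg) -cocycle_actM mulVg
    cocycle_act1.
have simb_trans : transitive cocycle_simb.
  move=> mu theta nu /exists_inP[g Gg Bg] /exists_inP[h Gh Bh].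
  apply/exists_inP; exists (g * h)%g; rewrite ?groupM // cocycle_actM.
  by apply: coboundary_sub_trans Bh; rewrite coboundary_sub_act.
by apply/equivalence_relP;
  split=> // theta mu /(left_trans simb_sym simb_trans).
Qed.

(** The map [v |-> theta - v] sends [B] bijectively onto this coset, which consists of cocycles
    because coboundaries are cocycles. *)
Lemma card_coboundary_coset theta :
  #|[set mu | (cocycle_fun theta - cocycle_fun mu)%R \in B]| = #|B|.
Proof.
rewrite -(card_imset _ val_inj) -(card_imset B (inv_inj (subKr (cocycle_fun
  theta)))).
congr #|pred_of_set _|; apply/setP=> u; apply/imsetP/imsetP => [[mu]|[v Bv ->]].
  rewrite inE => Bmu ->; exists (cocycle_fun theta - cocycle_fun mu)%R => //.
  by rewrite subKr.
have coc : is_cocycle (cocycle_fun theta - v)%R.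
  apply/forallP=> x; rewrite !ffunE cocycle1x cocyclex1.
  by have /forallP/(_ x)/andP[/eqP-> /eqP->] := coboundary_cocycle Bv;
    rewrite subrr eqxx.
by exists (Cocycle coc); rewrite // inE /= subKr.
Qed.

(* Count the pairs (g, mu) with g theta - mu in B in two ways; for mu in the
   class of theta, the possible g form a right coset of inv_stab theta. *)
Lemma card_sim_class theta :
  #|[set mu | cocycle_simb theta mu]| = (#|B| * #|G : inv_stab theta|%g)%N.
Proof.
(* Multiplying by the order of the stabilizer turns the index into [#|G|] by Lagrange. *)
apply/eqP; rewrite -(eqn_pmul2r (cardG_gt0 (inv_stab_group theta))) /=.
apply/eqP; transitivity (#|B| * #|G|)%N; last first.
  by rewrite -(Lagrange (inv_stab_sub theta)) /= mulnAC -mulnA.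
pose r g mu := (cocycle_act g theta - cocycle_fun mu)%R \in B.
transitivity (\sum_(g in G) \sum_(mu | r g mu) 1)%N; last first.
  rewrite (eq_bigr (fun=> #|B|)) => [|g Gg]; first
    by rewrite sum_nat_const mulnC.
  by rewrite sum1dep_card -(card_coboundary_coset (act_cocycle Gg theta)).
rewrite (exchange_big_dep (cocycle_simb theta)) /= => [|g mu Gg rmu];
  last first.
  by apply/exists_inP; exists g.
rewrite -sum1dep_card big_distrl /=; apply: eq_bigr => mu /exists_inP[h Gh rh].
rewrite mul1n sum1dep_card -(card_rcoset _ h); congr #|pred_of_set _|.
apply/setP=> g; rewrite mem_rcoset inE [in RHS]inE groupMr ?groupV //.
have [Gg /=|//] := boolP (g \in G).
have Ggh : (g * h^-1)%g \in G by rewrite groupM ?groupV.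
(* Acting by [h] turns the stabilizer condition on [g h^-1] into congruence of the translates of
   [theta] by [g] and [h]; [rh] then replaces the latter by [mu]. *)
rewrite inE coboundary_subC -(coboundary_sub_act _ _ Gh) -cocycle_actM mulgKV.
apply/idP/idP => [|rg]; first by move/coboundary_sub_trans; apply.
by apply: coboundary_sub_trans rg _; rewrite coboundary_subC.
Qed.

(** * Cardinalities of [InvS] and [InvSc], and the class formula *)

Lemma card_InvS_conj (H : {group {perm F} * {perm A}}) g :
  H \subset G -> g \in G -> #|InvS (H :^ g)%g| = #|InvS H|.
Proof.
move=> sHG Gg; have sHgG : (H :^ g \subset G)%g by rewrite -(conjGid Gg) conjSg.
(* Acting by [g] maps [InvS H] onto [InvS (H :^ g)], with inverse the action of [g^-1]. *)
have act_inj : injective (act_cocycle Gg).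
  move=> theta mu /(congr1 (cocycle_act g^-1%g \o @cocycle_fun _ _)) /=.
  by rewrite -!cocycle_actM mulgV !cocycle_act1 => /val_inj.
rewrite -[RHS](card_imset _ act_inj); congr #|pred_of_set _|.
apply/setP=> theta; apply/idP/imsetP => [|[mu + ->]]; last first.
  by rewrite !mem_InvS // inv_stab_act => /eqP->.
rewrite mem_InvS // => /eqP Stheta.
have Gg' : (g^-1)%g \in G by rewrite groupV.
exists (act_cocycle Gg' theta); first
  by rewrite mem_InvS // inv_stab_act Stheta conjsgK.
by apply: val_inj; rewrite /= -cocycle_actM mulVg cocycle_act1.
Qed.

Lemma mem_InvSc (H : {group {perm F} * {perm A}}) theta : H \subset G ->
  (theta \in InvSc H) = (inv_stab theta \in H :^: G)%g.
Proof.
move=> sHG; apply/bigcupP/imsetP => -[g Gg];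
  have sHgG : (H :^ g \subset G)%g by rewrite -(conjGid Gg) conjSg.
  by rewrite mem_InvS // => /eqP; exists g.
by move=> Stheta; exists g; rewrite // mem_InvS // Stheta.
Qed.

Lemma card_InvSc (H : {group {perm F} * {perm A}}) : H \subset G ->
  #|InvSc H| = (#|G : 'N_G(H)|%g * #|InvS H|)%N.
Proof.
move=> sHG; rewrite -sum1_card.
(* Splitting by the exact stabilizer gives one part [InvS K] for each conjugate [K] of [H]. *)
rewrite (partition_big (@inv_stab) [in (H :^: G)%g]) /= => [|theta]; last first.
  by rewrite mem_InvSc.
rewrite -card_conjugates -sum_nat_const.
apply: eq_bigr => _ /imsetP[g Gg ->];
  rewrite -(card_InvS_conj sHG Gg) sum1dep_card.
have sHgG : (H :^ g \subset G)%g by rewrite -(conjGid Gg) conjSg.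
congr #|pred_of_set _|; apply/setP=> theta;
  rewrite inE mem_InvS // mem_InvSc //.
by case: eqP => [->|]; rewrite ?andbF // imset_f.
Qed.

Lemma card_sim_classes (Subc : {set {group {perm F} * {perm A}}}) :
  subgroup_class_reps G Subc ->
  (#|equivalence_partition cocycle_simb [set: cocycle F A]|%:R =
   \sum_(H in Subc) #|InvSc H|%:R / (#|B|%:R * #|G : H|%g%:R) :> rat)%R.
Proof.
case=> subG repsP; rewrite -(sum_inv_card_class cocycle_simb_equiv).
(* Exactly one [H] in [Subc] satisfies [theta \in InvSc H], namely the representative of the class
   of [inv_stab theta], so the inner sum has a single term. *)
transitivity (\sum_theta \sum_(H in Subc | theta \in InvSc H)
    (#|B|%:R * #|G : H|%g%:R)^-1 : rat)%R; last first.
  rewrite (exchange_big_dep [in Subc]) /= => [|theta H _ /andP[]//].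
  apply: eq_bigr => H SubcH; rewrite [RHS]mulr_natl -[RHS]sumr_const.
  by apply: eq_bigl => theta; rewrite SubcH.
apply: eq_bigr => theta _.
have [H [[SubcH [g Gg HE]] Huniq]] := repsP (inv_stab_group theta)
  (inv_stab_sub theta).
(* Conjugate subgroups have the same index, so the weight may be written with [H]. *)
have cardH : #|G : H|%g = #|G : inv_stab theta|%g.
  by rewrite -!divgS ?inv_stab_sub ?subG // HE /= cardJg.
rewrite (big_pred1 H) => [|K /=]; first by rewrite card_sim_class natrM cardH.
apply/andP/eqP => [[SubcK] | ->]; last first.
  split=> //; rewrite mem_InvSc ?subG //; apply/imsetP; exists g^-1%g;
    rewrite ?groupV //.
  by rewrite HE /= conjsgK.
rewrite mem_InvSc ?subG // => /imsetP[h Gh hE]; apply/esym/Huniq.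
split=> //; exists h^-1%g; rewrite ?groupV //.
by apply: val_inj; rewrite /= hE conjsgK.
Qed.

End Counting.

(** * From similarity classes to isomorphism classes of extensions *)

Lemma separable_central_extension_count (F : finLoopType) (A : finZmodType) :
  (forall theta : cocycle F A, separable theta) ->
  central_extension_count A F
    #|equivalence_partition (@cocycle_simb F A) [set: cocycle F A]|.
Proof.
move=> hsep; set P := equivalence_partition _ _.
have simT : {in [set: cocycle F A] & &, equivalence_rel (@cocycle_simb F A)}.
  by move=> x y z _ _ _; apply: cocycle_simb_equiv.
(* Separability makes isomorphism of cocycle loops the same as lying in one block of [P]. *)
have isoP (theta mu : cocycle F A) :
    loop_iso (cocycle_loop theta) (cocycle_loop mu) <-> theta \in pblock P mu.
  rewrite (pblock_equivalence_partition simT) ?inE //.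
  split=> [/loop_iso_sym/hsep/cocycle_simP//|].
  by move/cocycle_simP/hsep/loop_iso_sym.
have [/eqP coverP tiP P0] := and3P (equivalence_partitionP simT).
have has_rep (k : 'I_#|P|) : exists theta, theta \in enum_val k.
  by apply/set0Pn; apply: contraNneq P0 => <-; apply: enum_valP.
have [rep repE] := choice has_rep.
have pblock_rep k : pblock P (rep k) = enum_val k.
  by apply: def_pblock (repE k); rewrite ?enum_valP.
exists (fun k => cocycle_loop (rep k)); split=> [k|k l|Q].
- exact: cocycle_loop_central_extension.
- move/isoP; rewrite pblock_rep => kl; apply: enum_val_inj.
  by rewrite -pblock_rep; apply: def_pblock kl; rewrite ?enum_valP.
- case/central_extension_cocycle=> theta Qtheta.
  have Ptheta : pblock P theta \in P by rewrite pblock_mem // coverP inE.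
  exists (enum_rank_in Ptheta (pblock P theta)); apply: loop_iso_trans Qtheta _.
  by apply/isoP; rewrite pblock_rep enum_rankK_in // mem_pblock coverP inE.
Qed.

Theorem theorem4p5 (F : finLoopType) (A : finZmodType)
    (hsep : forall theta : cocycle F A, separable theta)
    (Subc : {set {group {perm F} * {perm A}}})
    (hSubc : subgroup_class_reps (AutFA F A) Subc) :
  exists2 n : nat, central_extension_count A F n &
    (n%:R = \sum_(H in Subc)
       #|InvSc H|%:R / (#|coboundaries F A|%:R * #|AutFA F A : H|%g%:R) :> rat)%R
    /\
    (n%:R = \sum_(H in Subc)
       #|InvS H|%:R /
         (#|coboundaries F A|%:R * #|'N_(AutFA F A)(H) : H|%g%:R) :> rat)%R.
Proof.
exists #|equivalence_partition (@cocycle_simb F A) [set: cocycle F A]|.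
  exact: separable_central_extension_count.
rewrite (card_sim_classes hSubc); split=> //; apply: eq_bigr => H SubcH.
have sHG := hSubc.1 H SubcH.
(* Splitting [[G : H]] as [[G : N_G(H)] [N_G(H) : H]] exposes the factor [[G : N_G(H)]], which
   cancels against the one in [#|InvSc H|]. *)
rewrite (card_InvSc sHG) -(Lagrange_index (subsetIl (AutFA F A) 'N(H)%g)); last first.
  by rewrite subsetI sHG normG.
by rewrite !natrM [X in (_ / X)%R]mulrCA -mulf_div divff ?mul1r // pnatr_eq0 -lt0n.
Qed.
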